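(* Let $m \ge n \ge 2$ be integers and let $f(\hat{\mathbf x},\hat{\mathbf y})=\sum_{i,j=1}^m\sum_{k,l=1}^n a_{ijkl}x_ix_jy_ky_l$ be an $m\times n$ biquadratic polynomial with real coefficients, where $\hat{\mathbf x}=(x_1,\dots,x_m)^\top$ and $\hat{\mathbf y}=(y_1,\dots,y_n)^\top$. Then there is a tripartite homogeneous quartic polynomial $h(\mathbf x,\mathbf y,z)$ of $m+n-1$ variables, where $\mathbf x=(x_1,\dots,x_{m-1})^\top$, $\mathbf y=(y_1,\dots,y_{n-1})^\top$ and $z\in\mathbb R$, such that $f$ is PSD if and only if $h$ is PSD, and $f$ is SOS if and only if $h$ is SOS. In particular, every $2\times 2$ PSD biquadratic polynomial is a sum of squares of three quadratic polynomials.
   Context: A real polynomial is PSD (positive semi-definite) if it takes nonnegative values at all real points. It is SOS (sum of squares) if it is a finite sum of squares of real polynomials. An $m\times n$ biquadratic polynomial is a real polynomial of the form $\sum_{i,j=1}^m\sum_{k,l=1}^n a_{ijkl}x_ix_jy_ky_l$. A tripartite homogeneous quartic polynomial $h(\mathbf x,\mathbf y,z)$ with $\mathbf x\in\mathbb R^{m-1}$, $\mathbf y\in\mathbb R^{n-1}$, $z\in\mathbb R$ is a real homogeneous polynomial of degree $4$ in these $m+n-1$ variables such that in every term the total degree in the $x$-variables is at most $2$ and the total degree in the $y$-variables is at most $2$. *)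

(* Defs.v *)
From HB Require Import structures.
From mathcomp Require Import all_boot all_order all_algebra.
From mathcomp Require Import reals.
From mathcomp Require Import mpoly.
Set Implicit Arguments.
Unset Strict Implicit.
Unset Printing Implicit Defensive.
Import Order.TTheory GRing.Theory Num.Theory.
Local Open Scope ring_scope.

Definition psd (R : realType) (N : nat) (p : {mpoly R[N]}) : Prop :=
  forall v : 'I_N -> R, 0 <= p.@[v].

Definition sos (R : realType) (N : nat) (p : {mpoly R[N]}) : Prop :=
  exists s : seq {mpoly R[N]}, p = \sum_(q <- s) q ^+ 2.

(* Among the m + n variables, the first m are the x_i and the last n are the
   y_k.  No symmetry of the coefficients is assumed. *)
Definition biquadratic (R : realType) (m n : nat) (f : {mpoly R[m + n]}) :
    Prop :=
  exists a : 'I_m -> 'I_m -> 'I_n -> 'I_n -> R,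
    f = \sum_(i < m) \sum_(j < m) \sum_(k < n) \sum_(l < n)
          a i j k l *: ('X_(lshift n i) * 'X_(lshift n j) *
                        'X_(rshift m k) * 'X_(rshift m l)).

(* Among the p + q + 1 variables, the first p are the x_i, the next q are the
   y_k and the last one is z.  For a monomial t, t i is the exponent of the
   variable of index i.  The zero polynomial is included. *)
Definition tripartite_quartic (R : realType) (p q : nat)
    (h : {mpoly R[p + q + 1]}) : Prop :=
  h \is 4.-homog /\
  forall t : 'X_{1.. p + q + 1}, t \in msupp h ->
    (\sum_(i < p) t (lshift 1 (lshift q i)) <= 2)%N /\
    (\sum_(k < q) t (lshift 1 (rshift p k)) <= 2)%N.

(* Main.v *)
(** Put x_m = y_n = z in f to get h.  Conversely, the substitution
    x_i -> y_n x_i, y_k -> x_m y_k, z -> x_m y_n turns h into x_m^2 y_n^2 f,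
    and a factor X_j^2 may be removed from a PSD polynomial by continuity, and
    from a sum of squares because every squared polynomial vanishes on the
    hyperplane X_j = 0, hence is divisible by X_j.

    For m = n = 2, f is a quadratic form Q in the four products w_ik = x_i y_k,
    nonnegative on the quadric det w = 0, since the matrices of rank at most
    one are the products.  By the S-lemma some Q + l det is positive
    semidefinite; the least such l gives a singular Gram matrix, hence three
    squares. *)

Require Import Defs.
From HB Require Import structures.
From mathcomp Require Import all_boot all_order all_algebra.
From mathcomp Require Import reals.
From mathcomp Require Import classical_sets polyrcf ring lra.
From mathcomp Require Import mpoly.
Set Implicit Arguments.
Unset Strict Implicit.
Unset Printing Implicit Defensive.
Import Order.TTheory GRing.Theory Num.Theory.
Local Open Scope ring_scope.

(** * Polynomials that vanish at every point *)

Lemma poly_eval_eq0 (R : numDomainType) (p : {poly R}) :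
  (forall x, p.[x] = 0) -> p = 0.
Proof.
(* The naturals below [size p] stay distinct in [R], and they are more roots than the degree of a
   nonzero [p] allows. *)
move=> p0; apply: (@roots_geq_poly_eq0 _ p [seq i%:R | i <- iota 0 (size p)]).
- by apply/allP => x _; rewrite /root p0.
- rewrite map_inj_uniq ?iota_uniq // => i j /eqP.
  by rewrite eqr_nat => /eqP.
- by rewrite size_map size_iota.
Qed.

(** Lets [p = 0] be deduced from [muni p = 0], where [muni] reads [p] as a univariate polynomial in
    its last variable. *)
Lemma coef_muni n (R : nzRingType) (p : {mpoly R[n.+1]}) (m : 'X_{1..n.+1}) :
  ((muni p)`_(m ord_max))@_[multinom m (widen_ord (leqnSn n) i) | i < n] = p@_m.
Proof.
rewrite muniE coef_sum raddf_sum /=.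
rewrite [in RHS](mpolyE p) [in RHS]raddf_sum /=.
apply: eq_bigr => m' _.
rewrite coefZ coefXn mcoeffZ mcoeffX -scalerAl mcoeffZ; congr (_ * _).
case: (eqVneq m' m) => [->|neq]; first by rewrite eqxx mulr1 mcoeffX eqxx.
case: eqP => [eqmax|_]; last by rewrite mulr0 mcoeff0.
rewrite mulr1 mcoeffX; case: eqP => // /mnmP eqm; case/eqP: neq.
apply/mnmP => i; case: (unliftP ord_max i) => [j ->|->] //.
have -> : lift ord_max j = widen_ord (leqnSn n) j
  by apply: val_inj; exact: lift_max.
by have := eqm j; rewrite !mnmE.
Qed.

Lemma meval_muni n (R : comNzRingType) (p : {mpoly R[n.+1]}) (v : 'I_n.+1 -> R) :
  p.@[v] = (map_poly (meval (v \o widen_ord (leqnSn n))) (muni p)).[v ord_max].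
Proof.
rewrite muniE raddf_sum horner_sum mevalE; apply: eq_bigr => m _.
rewrite /= map_polyZ map_polyXn hornerZ hornerXn /= mevalZ mevalX.
rewrite big_ord_recr /= mulrA; congr (_ * _ * _).
by apply: eq_bigr => i _; rewrite mnmE.
Qed.

(** Induction on the number of variables: once the other variables are given values, the polynomial
    in the last one vanishes everywhere, so each of its coefficients vanishes at these values and
    the induction hypothesis applies to it. *)
Lemma mpoly_eval_eq0 (R : numDomainType) n (p : {mpoly R[n]}) :
  (forall v, p.@[v] = 0) -> p = 0.
Proof.
elim: n p => [|n IHn] p p0.
  have := p0 (fun=> 0); rewrite mevalE => p00.
  apply/mpolyP => m; rewrite mcoeff0 -[RHS]p00 [in LHS](mpolyE p) raddf_sum /=.
  apply: eq_bigr => m' _; rewrite big_ord0 mulr1 mcoeffZ mcoeffX.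
  have -> : m' = m by apply/mnmP => -[].
  by rewrite eqxx mulr1.
suff puni0 : muni p = 0 by apply/mpolyP => m; rewrite -coef_muni puni0 coef0 !mcoeff0.
apply/polyP => k; rewrite coef0; apply: IHn => v.
have -> : ((muni p)`_k).@[v] = (map_poly (meval v) (muni p))`_k by rewrite coef_map.
rewrite (_ : map_poly _ _ = 0) ?coef0 //; apply: poly_eval_eq0 => t.
pose w i := if unlift ord_max i is Some j then v j else t.
have wE : w \o widen_ord (leqnSn n) =1 v.
  move=> j; rewrite /= /w (_ : widen_ord _ j = lift ord_max j) ?liftK //.
  by apply: val_inj; exact/esym/lift_max.
have := p0 w; rewrite meval_muni {2}/w unlift_none => <-.
by congr _.[_]; apply: eq_map_poly => q; apply: meval_eq => j; rewrite wE.
Qed.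

(** * Substitution in PSD and SOS polynomials, and removal of a square factor *)

Section SosPsd.
Variable R : realType.

(** By linearity it suffices to treat monomials: setting ['X_j] to 0 fixes those free of ['X_j] and
    kills the others, which are multiples of ['X_j]. *)
Lemma substX_divX n (j : 'I_n) (p : {mpoly R[n]}) :
  exists g, p - (p \mPo [tuple if i == j then 0 else 'X_i | i < n]) = 'X_j * g.
Proof.
elim/mpolyind: p => [|c m p _ _ [g Hg]].
  by exists 0; rewrite comp_mpoly0 subr0 mulr0.
set s := [tuple _ | i < n] in Hg *.
suff [g' Hg'] : exists g', 'X_[m] - ('X_[m] \mPo s) = 'X_j * g'.
  exists (c *: g' + g).
  by rewrite comp_mpolyD comp_mpolyZ opprD addrACA -scalerBr Hg' Hg scalerAr mulrDr.
case: (posnP (m j)) => mj.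
  exists 0; rewrite mulr0; apply/eqP; rewrite subr_eq0; apply/eqP.
  rewrite comp_mpolyX mpolyXE_id; apply: eq_bigr => i _.
  by rewrite tnth_mktuple; case: eqP => // ->; rewrite mj !expr0.
exists 'X_[m - U_(j)].
rewrite comp_mpolyX (bigD1 j) //= tnth_mktuple eqxx expr0n eqn0Ngt mj mul0r subr0.
rewrite -mpolyXD addmC submK //; apply/mnm_lepP => i; rewrite mnm1E.
by case: eqP => // <-.
Qed.


Lemma comp_mpoly_sum_sqr n k (t : n.-tuple {mpoly R[k]})
    (s : seq {mpoly R[n]}) :
  (\sum_(q <- s) q ^+ 2) \mPo t = \sum_(q <- s) (q \mPo t) ^+ 2.
Proof. by rewrite raddf_sum; apply: eq_bigr => q _; rewrite /= rmorphXn. Qed.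

Lemma sos_comp n k (t : n.-tuple {mpoly R[k]}) (p : {mpoly R[n]}) :
  sos p -> sos (p \mPo t).
Proof.
case=> s ->; exists [seq q \mPo t | q <- s].
by rewrite comp_mpoly_sum_sqr big_map.
Qed.

Lemma psd_comp n k (t : n.-tuple {mpoly R[k]}) (p : {mpoly R[n]}) :
  psd p -> psd (p \mPo t).
Proof. by move=> p_ge0 v; rewrite comp_mpoly_meval. Qed.

Lemma sum_sqr_mpoly_eq0 n (s : seq {mpoly R[n]}) :
  \sum_(q <- s) q ^+ 2 = 0 -> forall q, q \in s -> q = 0.
Proof.
move=> s0 q qs; apply: mpoly_eval_eq0 => v.
have /eqP : \sum_(q <- s) q.@[v] ^+ 2 = 0.
  transitivity (\sum_(q <- s) q ^+ 2).@[v]; last by rewrite s0 meval0.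
  by rewrite raddf_sum; apply: eq_bigr => r _; rewrite /= rmorphXn.
rewrite psumr_eq0 => [|r _]; last exact: sqr_ge0.
by move=> /allP /(_ _ qs) /=; rewrite sqrf_eq0 => /eqP.
Qed.

Lemma sos_divX2 n (j : 'I_n) (p : {mpoly R[n]}) : sos ('X_j ^+ 2 * p) -> sos p.
Proof.
case=> s ps; pose t := [tuple if i == j then 0 else 'X_i | i < n] : n.-tuple {mpoly R[n]}.
(* Setting ['X_j] to 0 turns the given identity into a vanishing sum of squares. *)
have s0 : {in s, forall q, q \mPo t = 0}.
  move=> q qs; apply: (@sum_sqr_mpoly_eq0 _ [seq q \mPo t | q <- s]); last exact: map_f.
  rewrite big_map -comp_mpoly_sum_sqr -ps rmorphM rmorphXn /= comp_mpolyXU.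
  by rewrite -tnth_nth tnth_mktuple eqxx expr0n mul0r.
have [g sE] : exists g, s = [seq 'X_j * r | r <- g].
  elim: s s0 {ps} => [|q s IHs] s0; first by exists [::].
  have [r qr] := substX_divX j q; rewrite s0 ?mem_head ?subr0 // in qr.
  have [|g ->] := IHs; first by move=> q' qs; apply: s0; rewrite inE qs orbT.
  by exists (r :: g); rewrite /= qr.
exists g; apply: (@mulfI _ ('X_j ^+ 2)).
  rewrite expf_eq0 /=; apply/negP => /eqP /(congr1 (mcoeff U_(j))).
  by rewrite mcoeffXU eqxx mcoeff0 => /eqP; rewrite oner_eq0.
rewrite ps sE big_map mulr_sumr.
by apply: eq_bigr => q _; rewrite exprMn.
Qed.

Lemma horner_ge0_punctured (p : {poly R}) (a : R) :
  (forall t, t != a -> 0 <= p.[t]) -> 0 <= p.[a].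
Proof.
move=> p_ge0; rewrite leNgt; apply/negP => pa_lt0.
(* With tolerance [- p.[a]], continuity makes [p] negative on the whole [d]-neighbourhood of [a];
   the point [a + d / 2] then gives a contradiction. *)
have [d d_gt0 dP] := @poly_cont _ a p (- p.[a]) ltac:(by rewrite oppr_gt0).
have := dP (a + d / 2); rewrite addrAC subrr add0r gtr0_norm ?divr_gt0 //.
rewrite ltr_pdivrMr // mulr_natr mulr2n ltrDl => /(_ d_gt0).
have neq : a + d / 2 != a by rewrite -subr_eq0 addrAC subrr add0r gt_eqF // divr_gt0.
rewrite ger0_norm; first by rewrite ltrBDl subrr ltNge p_ge0.
by rewrite subr_ge0 (le_trans (ltW pa_lt0)) ?p_ge0.
Qed.

Lemma psd_divX2 n (j : 'I_n) (p : {mpoly R[n]}) : psd ('X_j ^+ 2 * p) -> psd p.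
Proof.
move=> p_ge0 v.
(* The restriction of [p] to the line through [v] parallel to the [j]-th axis. *)
pose P : {poly R} := mmap polyC (fun i => if i == j then 'X else (v i)%:P) p.
have PE t : P.[t] = p.@[fun i => if i == j then t else v i].
  rewrite /P /mmap horner_sum mevalE; apply: eq_bigr => m _.
  rewrite hornerCM /mmap1 horner_prod; congr (_ * _); apply: eq_bigr => i _.
  by rewrite horner_exp; case: eqP => _; rewrite ?hornerX ?hornerC.
have -> : p.@[v] = P.[v j].
  by rewrite PE; apply: meval_eq => i; case: eqP => // ->.
have nz t : t != 0 -> 0 <= P.[t].
  move=> t0; have := p_ge0 (fun i => if i == j then t else v i).
  rewrite mevalM rmorphXn /= mevalXU eqxx PE pmulr_rge0 //.
  by rewrite exprn_even_gt0.
have [->|] := eqVneq (v j) 0; last exact: nz.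
exact: horner_ge0_punctured.
Qed.

End SosPsd.

(** * Quadratic forms: Gram factorisation and the S-lemma *)

Section QuadraticForms.
Variable R : realType.

Definition qform n (A : 'M[R]_n) (w : 'rV[R]_n) : R := (w *m A *m w^T) 0 0.

Definition psdmx n (A : 'M[R]_n) := forall w, 0 <= qform A w.

Lemma qformD n (A B : 'M[R]_n) w : qform (A + B) w = qform A w + qform B w.
Proof. by rewrite /qform mulmxDr mulmxDl mxE. Qed.

Lemma qformZ n c (A : 'M[R]_n) w : qform (c *: A) w = c * qform A w.
Proof. by rewrite /qform -scalemxAr -scalemxAl mxE. Qed.

Lemma qformB n (A B : 'M[R]_n) w : qform (A - B) w = qform A w - qform B w.
Proof. by rewrite -scaleN1r qformD qformZ mulN1r. Qed.

Lemma qformZr n c (A : 'M[R]_n) w : qform A (c *: w) = c ^+ 2 * qform A w.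
Proof. by rewrite /qform linearZ /= -!scalemxAl -scalemxAr !mxE mulrA. Qed.

Lemma qform_congr n p (A : 'M[R]_n) (M : 'M[R]_(p, n)) w :
  qform (M *m A *m M^T) w = qform A (w *m M).
Proof. by rewrite /qform trmx_mul !mulmxA. Qed.

Lemma qform_tr n (A : 'M[R]_n) w : qform A^T w = qform A w.
Proof.
transitivity ((w *m A *m w^T)^T 0 0); last by rewrite mxE.
by rewrite !trmx_mul trmxK mulmxA.
Qed.

Lemma qform_delta n (i j : 'I_n) w : qform (delta_mx i j) w = w 0 i * w 0 j.
Proof.
rewrite /qform mxE (bigD1 j) //= !mxE (bigD1 i) //= !mxE !eqxx mulr1.
rewrite big1 => [|k ki]; last by rewrite mxE (negbTE ki) mulr0.
rewrite addr0 big1 ?addr0 // => k kj.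
rewrite !mxE big1 ?mul0r // => l _.
by rewrite mxE (negbTE kj) andbF mulr0.
Qed.

Lemma qformE n (A : 'M[R]_n) w :
  qform A w = \sum_i \sum_j A i j * (w 0 i * w 0 j).
Proof.
rewrite /qform exchange_big mxE; apply: eq_bigr => j _; rewrite !mxE mulr_suml.
by apply: eq_bigr => i _; ring.
Qed.

Lemma qform1 n (w : 'rV[R]_n) : qform 1%:M w = \sum_i w 0 i ^+ 2.
Proof. by rewrite /qform mulmx1 mxE; apply: eq_bigr => i _; rewrite mxE. Qed.

Lemma qform_gram n p (N : 'M[R]_(p, n)) w :
  qform (N^T *m N) w = \sum_i (\sum_j N i j * w 0 j) ^+ 2.
Proof.
have -> : N^T *m N = N^T *m 1%:M *m N^T^T by rewrite mulmx1 trmxK.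
rewrite qform_congr qform1.
apply: eq_bigr => i _; rewrite mxE; congr (_ ^+ 2); apply: eq_bigr => j _.
by rewrite mxE mulrC.
Qed.

Lemma psdmx_gram n p (N : 'M[R]_(p, n)) : psdmx (N^T *m N).
Proof. by move=> w; rewrite qform_gram sumr_ge0 // => i _; rewrite sqr_ge0. Qed.

Lemma qform_pairD n (A : 'M[R]_n) (u v : 'rV[R]_n) (a b : R) :
  qform A (a *: u + b *: v) =
  a ^+ 2 * qform A u + b ^+ 2 * qform A v
  + a * b * ((u *m A *m v^T) 0 0 + (v *m A *m u^T) 0 0).
Proof.
rewrite /qform linearD !linearZ /= !(mulmxDl, mulmxDr) -!(scalemxAl, scalemxAr) !mxE.
ring.
Qed.

(** A crude bound from |w_i w_j| <= |w|^2; it shows that the identity dominates a small multiple of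
    any form. *)
Lemma le_qform_norm1 n (K : 'M[R]_n) w :
  qform K w <= (\sum_i \sum_j `|K i j|) * qform 1%:M w.
Proof.
rewrite qformE mulr_suml; apply: ler_sum => i _; rewrite mulr_suml; apply: ler_sum => j _.
rewrite (le_trans (ler_norm _)) // normrM ler_wpM2l // normrM qform1.
have le_sum k : w 0 k ^+ 2 <= \sum_i w 0 i ^+ 2.
  by rewrite (bigD1 k) //= lerDl sumr_ge0 // => ? _; rewrite sqr_ge0.
have := le_sum i; have := le_sum j.
rewrite -(real_normK (num_real (w 0 i))) -(real_normK (num_real (w 0 j))).
have := normr_ge0 (w 0 i); have := normr_ge0 (w 0 j); nra.
Qed.

(** Induction through the Schur complement of the corner entry [a]. When [a = 0], positivity forces
    the row [b] to vanish, and the convention [0^-1 = 0] keeps the same formulas valid. *)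
Lemma cholesky n (A : 'M[R]_n) :
  A^T = A -> psdmx A -> exists M : 'M[R]_n, A = M^T *m M.
Proof.
elim: n A => [|n IHn] A; first by move=> _ _; exists 0; rewrite [LHS]flatmx0 [RHS]flatmx0.
rewrite -[n.+1]/(1 + n)%N in A *; rewrite -[A]submxK.
move: (ulsubmx A) (ursubmx A) (dlsubmx A) (drsubmx A) => a b c D {A}.
rewrite [a]mx11_scalar; move: (a 0 0) => {}a.
rewrite tr_block_mx => /eq_block_mx [_ _ <- Dsym] Apsd {c}.
have qE x u : qform (block_mx a%:M b b^T D) (row_mx x%:M u) =
    a * x ^+ 2 + 2 * x * (b *m u^T) 0 0 + qform D u.
  rewrite /qform tr_row_mx mul_row_block mul_row_col.
  have -> : u *m b^T = (b *m u^T)^T by rewrite trmx_mul trmxK.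
  rewrite !(tr_scalar_mx, mul_scalar_mx, mul_mx_scalar, mulmxDl) -?scalemxAl.
  by rewrite !mxE eqxx mulr1n; ring.
have a_ge0 : 0 <= a.
  have := Apsd (row_mx 1%:M 0); rewrite qE trmx0 mulmx0 mxE /qform mul0mx mul0mx mxE.
  by rewrite expr1n mulr1 mulr0 !addr0.
have ab k : a = 0 -> b 0 k = 0.
  move=> a0; apply/eqP/negPn/negP => bk.
  (* The first coordinate is chosen so that the form takes the value -1. *)
  have := Apsd (row_mx (- (D k k + 1) / (2 * b 0 k))%:M (delta_mx 0 k)).
  rewrite qE a0 mul0r add0r /qform trmx_delta -rowE -!colE !mxE.
  have -> : 2 * (- (D k k + 1) / (2 * b 0 k)) * b 0 k = - (D k k + 1) by field.
  lra.
have [|u|M' M'E] := IHn (D - a^-1 *: (b^T *m b)).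
- by rewrite linearB linearZ /= trmx_mul trmxK Dsym.
(* For fixed [u] and [a != 0], this first coordinate minimises the form, and the minimum is the
   value of the Schur complement at [u]. *)
- have := Apsd (row_mx (- a^-1 * (b *m u^T) 0 0)%:M u); rewrite qE qformB qformZ.
  have -> : qform (b^T *m b) u = (b *m u^T) 0 0 ^+ 2.
    rewrite qform_gram big_ord1 mxE; congr (_ ^+ 2).
    by apply: eq_bigr => j _; rewrite mxE.
  have [->|a0] := eqVneq a 0; first by rewrite invr0; lra.
  set beta := (b *m u^T) 0 0; congr (0 <= _); rewrite -[LHS]/(_ + _).
  by field.
exists (block_mx (Num.sqrt a)%:M ((Num.sqrt a)^-1 *: b) 0 M').
rewrite tr_block_mx mulmx_block tr_scalar_mx !trmx0 !mul0mx !mulmx0 !addr0 -M'E.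
have -> : ((Num.sqrt a)^-1 *: b)^T = (Num.sqrt a)^-1 *: b^T by rewrite linearZ.
rewrite -!scalemxAl -!scalemxAr !mul_scalar_mx mul_mx_scalar !scalerA.
rewrite scale_scalar_mx -invfM -!expr2 sqr_sqrtr //.
rewrite [a^-1 *: _ + _]addrC subrK.
have sb : ((Num.sqrt a)^-1 * Num.sqrt a) *: b = b.
  apply/rowP => k; rewrite mxE; have [a0|a0] := eqVneq a 0; first by rewrite ab // mulr0.
  by rewrite mulVf ?mul1r // sqrtr_eq0 -ltNge lt0r a0.
by rewrite -linearZ /= sb.
Qed.


(** The rank is at most [n], so the factorisation by column and row bases passes through dimension
    [n]. *)
Lemma singular_factor n (M : 'M[R]_n.+1) : M \notin unitmx ->
  exists (B : 'M[R]_(n.+1, n)) (C : 'M[R]_(n, n.+1)), M = B *m C.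
Proof.
rewrite -row_free_unit => Mns.
have rM : (\rank M <= n)%N by rewrite -ltnS ltn_neqAle rank_leq_row andbT.
exists (col_ebase M *m pid_mx (\rank M)), (pid_mx (\rank M) *m row_ebase M).
by rewrite mulmxA -[_ *m _ *m pid_mx _]mulmxA pid_mx_id // mulmx_ebase.
Qed.

(* Some a makes both a u + v and - u + a v isotropic for S; the values of Q at
   these two vectors add up to (a^2 + 1) (Q u + Q v). *)
Lemma s_lemma_pair n (Q S : 'M[R]_n) u v :
  (forall w, qform S w = 0 -> 0 <= qform Q w) ->
  qform S v = - qform S u -> 0 <= qform Q u + qform Q v.
Proof.
move=> QS Sv; set e := qform S u in Sv.
have [e0|e0] := eqVneq e 0.
  by rewrite addr_ge0 // QS // Sv e0 oppr0.
pose B := (u *m S *m v^T) 0 0 + (v *m S *m u^T) 0 0.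
pose C := (u *m Q *m v^T) 0 0 + (v *m Q *m u^T) 0 0.
pose s := Num.sqrt (B ^+ 2 + 4 * e ^+ 2).
have sE : s ^+ 2 = B ^+ 2 + 4 * e ^+ 2.
  by rewrite sqr_sqrtr // addr_ge0 ?sqr_ge0 // mulr_ge0 ?sqr_ge0.
pose a := (s - B) / (2 * e).
have aE : e * a ^+ 2 + B * a - e = 0 by rewrite /a; field: sE.
have h1 : 0 <= qform Q (a *: u + 1 *: v).
  by apply: QS; rewrite qform_pairD Sv -/e -/B -[RHS]aE; ring.
have h2 : 0 <= qform Q ((-1) *: u + a *: v).
  by apply: QS; rewrite qform_pairD Sv -/e -/B -[RHS]oppr0 -[in RHS]aE; ring.
move: h1 h2; rewrite !qform_pairD -/C => h1 h2.
have : 0 <= (a ^+ 2 + 1) * (qform Q u + qform Q v) by lra.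
by rewrite pmulr_rge0 // ltr_wpDl ?sqr_ge0.
Qed.

(** Nonnegativity of Q + l S at [u] bounds l below by - Q u / S u when S u > 0, and above by the
    same ratio when S u < 0. By [cross] no lower bound exceeds an upper one, so the supremum of the
    lower bounds is the least admissible l. *)
Lemma s_lemma_min n (Q S : 'M[R]_n) :
  (exists u, 0 < qform S u) -> (exists u, qform S u < 0) ->
  (forall w, qform S w = 0 -> 0 <= qform Q w) ->
  exists l, psdmx (Q + l *: S) /\
    forall e, 0 < e -> ~ psdmx (Q + (l - e) *: S).
Proof.
move=> [u0 u0P] [v0 v0P] QS.
have cross u v : 0 < qform S u -> qform S v < 0 ->
    - qform Q u / qform S u <= - qform Q v / qform S v.
  move=> Su Sv.
  have Sv' : 0 <= - qform S v by rewrite oppr_ge0 ltW.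
  (* The square roots rescale [u] and [v] so that S takes opposite values on them. *)
  have := @s_lemma_pair _ Q S (Num.sqrt (- qform S v) *: u)
    (Num.sqrt (qform S u) *: v) QS.
  rewrite !qformZr !sqr_sqrtr ?(ltW Su) // => h.
  have {}h : 0 <= - qform S v * qform Q u + qform S u * qform Q v by apply: h; ring.
  by rewrite ler_pdivrMr // mulrAC ler_ndivlMr //; lra.
pose E := [set l | exists2 u, 0 < qform S u & l = - qform Q u / qform S u]%classic.
have E_sup : has_sup E.
  split; first by exists (- qform Q u0 / qform S u0), u0.
  by exists (- qform Q v0 / qform S v0) => _ [u Su ->]; exact: cross.
exists (sup E); split=> [w|e e0 npsd].
  rewrite qformD qformZ; have [Sw|Sw|Sw] := ltrgtP (qform S w) 0.
  - have : sup E <= - qform Q w / qform S w.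
      by apply: ge_sup; [exact: E_sup.1|move=> _ [u Su ->]; exact: cross].
    by rewrite ler_ndivlMr //; lra.
  - have : - qform Q w / qform S w <= sup E by apply: sup_upper_bound => //; exists w.
    by rewrite ler_pdivrMr //; lra.
  - by rewrite Sw mulr0 addr0 QS.
(* Some ratio exceeds [sup E - e]; at its [u] the form with parameter [sup E - e] is negative. *)
have [_ [u Su ->]] := sup_adherent e0 E_sup.
rewrite ltr_pdivlMr // => h; have := npsd u; rewrite qformD qformZ; lra.
Qed.

(** For invertible [M] the form of [A] would be positive definite, and a small multiple of [S] could
    still be subtracted. *)
Lemma gram_nsingular n (A S M : 'M[R]_n) : A = M^T *m M ->
  (forall e, 0 < e -> ~ psdmx (A - e *: S)) -> M \notin unitmx.
Proof.
move=> AE Amin; apply/negP => Mu.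
(* [K] is the form [S] in the coordinates [w *m M^T], in which [A] becomes the identity. *)
pose K := (invmx M)^T *m S *m invmx M.
pose c := \sum_i \sum_j `|K i j| + 1.
have c_gt0 : 0 < c.
  by rewrite ltr_wpDl // sumr_ge0 // => i _; rewrite sumr_ge0.
apply: (Amin c^-1) => [|w]; first by rewrite invr_gt0.
have SE : S = M^T *m K *m M^T^T.
  rewrite /K trmxK !mulmxA -trmx_mul mulVmx // trmx1 mul1mx.
  by rewrite -mulmxA mulVmx // mulmx1.
have {}AE : A = M^T *m 1%:M *m M^T^T by rewrite mulmx1 trmxK.
rewrite qformB qformZ SE AE !qform_congr.
set y := w *m _; have := le_qform_norm1 K y.
have y0 : 0 <= qform 1%:M y by rewrite qform1 sumr_ge0 // => i _; rewrite sqr_ge0.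
rewrite subr_ge0 ler_pdivrMl // => /le_trans; apply.
by rewrite ler_wpM2r // lerDl.
Qed.

(** Minimality of l makes the factor [M] of Q + l S singular, and this lowers the number of squares
    from [n.+1] to [n]. *)
Lemma s_lemma_gram n (Q S : 'M[R]_n.+1) : Q^T = Q -> S^T = S ->
  (exists u, 0 < qform S u) -> (exists u, qform S u < 0) ->
  (forall w, qform S w = 0 -> 0 <= qform Q w) ->
  exists (N : 'M[R]_(n, n.+1)), forall w, qform S w = 0 ->
    qform Q w = \sum_i (\sum_j N i j * w 0 j) ^+ 2.
Proof.
move=> Qs Ss Sp Sn QS; have [l [lP lmin]] := s_lemma_min Sp Sn QS.
have [|M ME] := cholesky _ lP; first by rewrite linearD linearZ /= Qs Ss.
have [|B [C MBC]] := @singular_factor _ M.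
  apply: (gram_nsingular ME (S := S)) => e e0; have := lmin e e0.
  by rewrite scalerBl addrA.
(* With M = B C, the inner Gram matrix has size [n]; factoring it again leaves only [n] rows. *)
have [|N NE] := @cholesky _ (B^T *m B) _ (psdmx_gram B).
  by rewrite trmx_mul trmxK.
exists (N *m C) => w Sw; rewrite -qform_gram.
have -> : qform Q w = qform (Q + l *: S) w by rewrite qformD qformZ Sw mulr0 addr0.
by rewrite ME MBC !trmx_mul !mulmxA -[C^T *m _ *m B]mulmxA NE !mulmxA.
Qed.

End QuadraticForms.

(** * Passage between biquadratic and tripartite quartic polynomials *)

Lemma split_ordl (m n : nat) (i : 'I_m) : split (lshift n i) = inl i.
Proof. exact: (unsplitK (inl i)). Qed.

Lemma split_ordr (m n : nat) (i : 'I_n) : split (rshift m i) = inr i.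
Proof. exact: (unsplitK (inr i)). Qed.

Section Dehomogenization.
Variables (R : realType) (p q : nat).
Local Notation N := (p.+1 + q.+1)%N.

(** The index [ord_max] of either block, that of x_m or y_n, is sent to the index of z. *)
Definition merge_var (i : 'I_N) : 'I_(p + q + 1) :=
  match split i with
  | inl i' => if unlift ord_max i' is Some j then lshift 1 (lshift q j)
              else rshift (p + q) ord0
  | inr k' => if unlift ord_max k' is Some l then lshift 1 (rshift p l)
              else rshift (p + q) ord0
  end.

Definition merge_tuple : N.-tuple {mpoly R[p + q + 1]} :=
  [tuple 'X_(merge_var i) | i < N].

Let xlast : 'I_N := lshift q.+1 ord_max.
Let ylast : 'I_N := rshift p.+1 ord_max.

(** The affine coordinates x_j / x_m, y_l / y_n and 1, multiplied by x_m y_n to clear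
    denominators. *)
Definition split_tuple : (p + q + 1).-tuple {mpoly R[N]} :=
  [tuple match split i with
         | inl i' =>
           match split i' with
           | inl j => 'X_ylast * 'X_(lshift q.+1 (lift ord_max j))
           | inr l => 'X_xlast * 'X_(rshift p.+1 (lift ord_max l))
           end
         | inr _ => 'X_xlast * 'X_ylast
         end | i < p + q + 1].

(** The last x-variable needs no separate formula: it becomes z, whose image is x_m y_n. *)
Lemma split_merge_x (i : 'I_p.+1) :
  tnth split_tuple (merge_var (lshift q.+1 i)) = 'X_ylast * 'X_(lshift q.+1 i).
Proof.
rewrite tnth_mktuple /merge_var split_ordl.
by case: unliftP => [j|] ->; rewrite ?split_ordl // split_ordr mulrC.
Qed.

Lemma split_merge_y (k : 'I_q.+1) :
  tnth split_tuple (merge_var (rshift p.+1 k)) = 'X_xlast * 'X_(rshift p.+1 k).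
Proof.
rewrite tnth_mktuple /merge_var split_ordr.
by case: unliftP => [j|] ->; rewrite ?split_ordl ?split_ordr.
Qed.

Lemma merge_biquadraticE (a : 'I_p.+1 -> 'I_p.+1 -> 'I_q.+1 -> 'I_q.+1 -> R) :
  (\sum_i \sum_j \sum_k \sum_l
     a i j k l *: ('X_(lshift q.+1 i) * 'X_(lshift q.+1 j) *
                   'X_(rshift p.+1 k) * 'X_(rshift p.+1 l))) \mPo merge_tuple =
  \sum_i \sum_j \sum_k \sum_l
     a i j k l *: ('X_(merge_var (lshift q.+1 i)) * 'X_(merge_var (lshift q.+1 j)) *
                   'X_(merge_var (rshift p.+1 k)) * 'X_(merge_var (rshift p.+1 l))).
Proof.
do 4![rewrite raddf_sum /=; apply: eq_bigr => ? _].
by rewrite comp_mpolyZ !rmorphM /= !comp_mpolyXU -!tnth_nth !tnth_mktuple.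
Qed.

(** Each term has two x-factors, each gaining y_n, and two y-factors, each gaining x_m. *)
Lemma split_mergeE (f : {mpoly R[N]}) : biquadratic f ->
  (f \mPo merge_tuple) \mPo split_tuple = 'X_xlast ^+ 2 * ('X_ylast ^+ 2 * f).
Proof.
case=> a ->; rewrite merge_biquadraticE.
do 4![rewrite raddf_sum /= !mulr_sumr; apply: eq_bigr => ? _].
rewrite comp_mpolyZ !rmorphM /= !comp_mpolyXU -!tnth_nth.
rewrite !split_merge_x !split_merge_y -!scalerAr; congr (_ *: _); ring.
Qed.

Lemma tripartite_quartic0 : tripartite_quartic (0 : {mpoly R[p + q + 1]}).
Proof. by split=> [|t]; [exact: dhomog0 | rewrite -mpolyC0 msupp0]. Qed.

Lemma tripartite_quarticD (f g : {mpoly R[p + q + 1]}) :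
  tripartite_quartic f -> tripartite_quartic g -> tripartite_quartic (f + g).
Proof.
move=> [fh fs] [gh gs]; split=> [|t /msuppD_le]; first exact: dhomogD.
by rewrite mem_cat => /orP[/fs|/gs].
Qed.

Lemma tripartite_quarticZ c (f : {mpoly R[p + q + 1]}) :
  tripartite_quartic f -> tripartite_quartic (c *: f).
Proof.
by move=> [fh fs]; split=> [|t /msuppZ_le]; [exact: dhomogZ | exact: fs].
Qed.

(** Used to count x-degrees: x_m becomes z and contributes nothing. *)
Lemma merge_var_xdeg (i : 'I_N) :
  (\sum_(j < p) U_(merge_var i)%MM (lshift 1 (lshift q j)) =
    (if split i is inl i' then i' != ord_max else false))%N.
Proof.
rewrite /merge_var; case: splitP => [i' _|k' _].
  case: unliftP => [j ->|->].
    rewrite (bigD1 j) //= mnm1E eqxx big1 ?addn0 => [|j' j'j].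
      by rewrite eq_sym neq_lift.
    by rewrite mnm1E !(inj_eq (@lshift_inj _ _)) eq_sym (negbTE j'j).
  by rewrite big1 ?eqxx // => j _; rewrite mnm1E eq_rlshift.
case: unliftP => [l _|_]; rewrite big1 // => j _; rewrite mnm1E ?eq_rlshift //.
by rewrite (inj_eq (@lshift_inj _ _)) eq_rlshift.
Qed.

Lemma merge_var_ydeg (i : 'I_N) :
  (\sum_(l < q) U_(merge_var i)%MM (lshift 1 (rshift p l)) =
    (if split i is inr k' then k' != ord_max else false))%N.
Proof.
rewrite /merge_var; case: splitP => [i' _|k' _].
  case: unliftP => [j _|_]; rewrite big1 // => l _; rewrite mnm1E ?eq_rlshift //.
  by rewrite (inj_eq (@lshift_inj _ _)) eq_lrshift.
case: unliftP => [l ->|->].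
  rewrite (bigD1 l) //= mnm1E eqxx big1 ?addn0 => [|l' l'l].
    by rewrite eq_sym neq_lift.
  rewrite mnm1E (inj_eq (@lshift_inj _ _)) (inj_eq (@rshift_inj _ _)).
  by rewrite eq_sym (negbTE l'l).
by rewrite big1 ?eqxx // => j _; rewrite mnm1E eq_rlshift.
Qed.

Lemma tripartite_merge_monomial i j k l :
  tripartite_quartic
    ('X_(merge_var (lshift q.+1 i)) * 'X_(merge_var (lshift q.+1 j)) *
     'X_(merge_var (rshift p.+1 k)) * 'X_(merge_var (rshift p.+1 l)) :
       {mpoly R[p + q + 1]}).
Proof.
rewrite -!mpolyXD; split=> [|t]; first by rewrite dhomogX /= !mdegD !mdeg1.
rewrite msuppX inE => /eqP ->.
under eq_bigr do rewrite !mnmDE.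
under [X in _ /\ (X <= 2)%N]eq_bigr do rewrite !mnmDE.
rewrite !big_split /= !merge_var_xdeg !merge_var_ydeg !split_ordl !split_ordr.
by do 4!case: (_ != _).
Qed.

Lemma tripartite_merge (f : {mpoly R[N]}) :
  biquadratic f -> tripartite_quartic (f \mPo merge_tuple).
Proof.
case=> a ->; rewrite merge_biquadraticE.
do 4![elim/big_ind: _ => [||? _];
  [exact: tripartite_quartic0 | exact: tripartite_quarticD |]].
exact/tripartite_quarticZ/tripartite_merge_monomial.
Qed.

Lemma psd_merge (f : {mpoly R[N]}) :
  biquadratic f -> psd f <-> psd (f \mPo merge_tuple).
Proof.
move=> fb; split; first exact: psd_comp.
by move=> /(psd_comp split_tuple); rewrite split_mergeE // => /psd_divX2 /psd_divX2.
Qed.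

Lemma sos_merge (f : {mpoly R[N]}) :
  biquadratic f -> sos f <-> sos (f \mPo merge_tuple).
Proof.
move=> fb; split; first exact: sos_comp.
by move=> /(sos_comp split_tuple); rewrite split_mergeE // => /sos_divX2 /sos_divX2.
Qed.

End Dehomogenization.

(** * Three squares for 2 x 2 biquadratic polynomials *)

Section TwoByTwo.
Variable R : realType.

Lemma det_mx22 (A : 'M[R]_2) : \det A = A 0 0 * A 1 1 - A 0 1 * A 1 0.
Proof.
have l1 : lift ord0 ord0 = 1 :> 'I_2 by apply: val_inj.
have l0 : lift 1 ord0 = 0 :> 'I_2 by apply: val_inj.
rewrite (expand_det_row _ 0) !big_ord_recl big_ord0 /cofactor !det_mx11 !mxE /=.
by rewrite !l1 l0 expr0 expr1; ring.
Qed.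

(** Supplies the symmetry required by the Gram factorisation, since neither the coefficients [a] nor
    [det2_gram] need be symmetric. *)
Definition symmx n (A : 'M[R]_n) := 2^-1 *: (A + A^T).

Lemma qform_symmx n (A : 'M[R]_n) w : qform (symmx A) w = qform A w.
Proof. by rewrite qformZ qformD qform_tr; field. Qed.

Lemma tr_symmx n (A : 'M[R]_n) : (symmx A)^T = symmx A.
Proof. by rewrite linearZ linearD /= trmxK addrC. Qed.

(** The biquadratic polynomial read as a quadratic form in independent entries w_ik, flattened by
    [mxvec]. *)
Definition bilin_gram m n (a : 'I_m -> 'I_m -> 'I_n -> 'I_n -> R) : 'M[R]_(m * n) :=
  \sum_(i < m) \sum_(j < m) \sum_(k < n) \sum_(l < n)
    a i j k l *: delta_mx (mxvec_index i k) (mxvec_index j l).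

Lemma qform_bilin_gram m n (a : 'I_m -> 'I_m -> 'I_n -> 'I_n -> R) (W : 'M[R]_(m, n)) :
  qform (bilin_gram a) (mxvec W) =
  \sum_(i < m) \sum_(j < m) \sum_(k < n) \sum_(l < n) a i j k l * (W i k * W j l).
Proof.
have qform0 : qform 0 (mxvec W) = 0 by rewrite /qform mulmx0 mul0mx mxE.
have qform_sum := big_morph (fun A => qform A (mxvec W))
  (fun A B => @qformD R _ A B (mxvec W)) qform0.
do 4![rewrite qform_sum; apply: eq_bigr => ? _].
by rewrite qformZ qform_delta !mxvecE.
Qed.

Definition det2_gram : 'M[R]_(2 * 2) :=
  delta_mx (mxvec_index 0 0) (mxvec_index 1 1)
  - delta_mx (mxvec_index 0 1) (mxvec_index 1 0).

Lemma qform_det2_gram (W : 'M[R]_2) : qform det2_gram (mxvec W) = \det W.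
Proof. by rewrite qformB !qform_delta !mxvecE det_mx22. Qed.

Lemma biquadratic2_sum_sqr3 (f : {mpoly R[2 + 2]}) :
  @biquadratic R 2 2 f -> psd f ->
  exists q : 'I_3 -> {mpoly R[2 + 2]},
    (forall i, q i \is 2.-homog) /\ f = \sum_(i < 3) q i ^+ 2.
Proof.
case=> a fE f_ge0.
pose W v : 'M[R]_2 := \matrix_(i, k) (v (lshift 2 i) * v (rshift 2 k)).
have fv v : f.@[v] = qform (bilin_gram a) (mxvec (W v)).
  rewrite qform_bilin_gram fE.
  do 4![rewrite raddf_sum /=; apply: eq_bigr => ? _].
  by rewrite mevalZ !mevalM !mevalXU !mxE; ring.
have detW v : \det (W v) = 0 by rewrite det_mx22 !mxE; ring.
have detE w : qform (symmx det2_gram) w = \det (vec_mx w).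
  by rewrite qform_symmx -{1}[w]vec_mxK qform_det2_gram.
have [|||N NE] :=
    @s_lemma_gram R 3 (symmx (bilin_gram a)) (symmx det2_gram) (tr_symmx _) (tr_symmx _).
(* The identity and diag(1, -1) give the determinant form both signs. *)
- exists (mxvec (1%:M : 'M[R]_2)); rewrite detE mxvecK det1; exact: ltr01.
- exists (mxvec (delta_mx 0 0 - delta_mx 1 1 : 'M[R]_2)).
  rewrite detE mxvecK det_mx22 !mxE /=; lra.
- rewrite -[3.+1]/(2 * 2)%N => w w0; rewrite qform_symmx.
  (* A singular 2 x 2 matrix is a column times a row, hence some [W v], where the form is a value of
     [f]. *)
  have [|B [C WE]] := @singular_factor _ 1 (vec_mx w).
    by rewrite unitmxE -detE w0 unitr0.
  pose v (i : 'I_(2 + 2)) := match split i with inl i' => B i' 0 | inr k' => C 0 k' end.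
  rewrite -[w]vec_mxK WE (_ : B *m C = W v) -?fv //.
  by apply/matrixP => i k; rewrite !mxE big_ord1 /v split_ordl split_ordr.
(* The generic counterpart of [W]: the rows of [N] applied to its entries give the three
   quadratics. *)
pose X : 'M[{mpoly R[2 + 2]}]_2 := \matrix_(i, k) ('X_(lshift 2 i) * 'X_(rshift 2 k)).
exists (fun i => \sum_(j < 2 * 2) N i j *: mxvec X 0 j); split=> [i|].
  apply: rpred_sum => j _; apply: rpredZ; case/mxvec_indexP: j => k l.
  by rewrite mxvecE mxE -mpolyXD dhomogX /= mdegD !mdeg1.
(* Comparing values suffices, and every [W v] lies on the quadric where the Gram identity holds. *)
apply/eqP; rewrite -subr_eq0; apply/eqP/mpoly_eval_eq0 => v.
apply/eqP; rewrite mevalB subr_eq0 fv -qform_symmx NE ?detE ?mxvecK //; apply/eqP.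
rewrite raddf_sum /=; apply: eq_bigr => i _.
rewrite rmorphXn /= raddf_sum /=; congr (_ ^+ 2); apply: eq_bigr => j _.
rewrite mevalZ; congr (_ * _); case: (@mxvec_indexP 2 2 j) => k l.
transitivity (W v k l); first exact: mxvecE.
by rewrite mxvecE !mxE mevalM !mevalXU.
Qed.

End TwoByTwo.

Theorem theorem2p1 (R : realType) :
  (forall (m n : nat) (f : {mpoly R[m + n]}),
     (2 <= n)%N -> (n <= m)%N -> biquadratic f ->
     exists h : {mpoly R[m.-1 + n.-1 + 1]},
       [/\ tripartite_quartic h, psd f <-> psd h & sos f <-> sos h]) /\
  (forall f : {mpoly R[2 + 2]},
     @biquadratic R 2 2 f -> psd f ->
     exists q : 'I_3 -> {mpoly R[2 + 2]},
       (forall i, q i \is 2.-homog) /\ f = \sum_(i < 3) q i ^+ 2).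
Proof.
split; last exact: biquadratic2_sum_sqr3.
move=> [|p] [|q] // f _ _ fb; exists (f \mPo merge_tuple R p q); split.
- exact: tripartite_merge.
- exact: psd_merge.
- exact: sos_merge.
Qed.
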